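(* Let $r>0$, $r\neq 1$, and $b>0$. Then for each fixed admissible wave speed $c$ the monotone wavefront $(u,v)(t,x)=(\phi,\theta)(\nu\cdot x+ct)$, $|\nu|=1$, of the system $$u_t=\Delta u+u(1-u-rv),\qquad v_t=\Delta v-buv$$ connecting the equilibria $(0,1)$ and $(1,0)$ is unique up to a translation. That is, if $(\phi_1,\theta_1)$ and $(\phi_2,\theta_2)$ are profiles of positive monotone wavefronts connecting $(0,1)$ with $(1,0)$ and having the same speed $c$, then there is $s\in\mathbb{R}$ such that $(\phi_1,\theta_1)(t+s)=(\phi_2,\theta_2)(t)$ for all $t\in\mathbb{R}$.
   Context: A wavefront with speed $c\in\mathbb{R}$ connecting $(0,1)$ with $(1,0)$ is a solution of the form $(u,v)(t,x)=(\phi,\theta)(\nu\cdot x+ct)$, $|\nu|=1$, where the profile $(\phi,\theta)$ consists of $C^2$ functions on $\mathbb{R}$ with $(\phi,\theta)(-\infty)=(0,1)$ and $(\phi,\theta)(+\infty)=(1,0)$. Equivalently, the profile satisfies $$\phi''-c\phi'+\phi(1-\phi-r\theta)=0,\qquad \theta''-c\theta'-b\phi\theta=0\quad\text{on }\mathbb{R}$$ with these limits. A positive monotone wavefront is a wavefront with $\phi>0$, $\theta>0$ and both $\phi,\theta$ monotone. A speed $c$ is admissible if there is a positive monotone wavefront with speed $c$ connecting $(0,1)$ with $(1,0)$. *)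

(* Defs.v *)
(* Stdlib real numbers with Coquelicot's total derivatives and limits; the
   finite index type and iterated sums are those of MathComp. *)
From Stdlib Require Import Reals Lra.
From mathcomp Require Import all_boot.
From Coquelicot Require Import Coquelicot.

Set Implicit Arguments.
Unset Strict Implicit.
Unset Printing Implicit Defensive.

Open Scope R_scope.

(* Points of R^n are coordinate functions 'I_n -> R. *)
Definition dot (n : nat) (x y : 'I_n -> R) : R :=
  \big[Rplus/0]_(i < n) (x i * y i).

Definition euclidean_norm (n : nat) (x : 'I_n -> R) : R := sqrt (dot x x).

Definition update (n : nat) (x : 'I_n -> R) (i : 'I_n) (s : R) : 'I_n -> R :=
  fun j => if j == i then s else x j.

Definition laplacian (n : nat) (f : ('I_n -> R) -> R) (x : 'I_n -> R) : R :=
  \big[Rplus/0]_(i < n) Derive_n (fun s => f (update x i s)) 2 (x i).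

(* [Derive] and [Derive_n] are total, with an arbitrary value where the
   derivative does not exist; below, [solves_system] is only used for
   u and v built from C^2 profiles, for which all derivatives exist. *)
Definition solves_system (n : nat) (r b : R) (u v : R -> ('I_n -> R) -> R) :
  Prop :=
  forall (t : R) (x : 'I_n -> R),
    Derive (fun tau => u tau x) t =
      laplacian (u t) x + u t x * (1 - u t x - r * v t x) /\
    Derive (fun tau => v tau x) t =
      laplacian (v t) x - b * u t x * v t x.

(* All orders up to 2 are listed because [ex_derive_n f 2 x] alone does not
   entail differentiability of f. *)
Definition C2 (f : R -> R) : Prop :=
  (forall (k : nat) (x : R), (k <= 2)%N -> ex_derive_n f k x) /\
  (forall x : R, continuous (Derive_n f 2) x).

Definition plane_wave (n : nat) (c : R) (nu : 'I_n -> R) (f : R -> R) :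
  R -> ('I_n -> R) -> R :=
  fun t x => f (dot nu x + c * t).

Record is_wavefront (n : nat) (r b c : R) (nu : 'I_n -> R)
    (phi theta : R -> R) : Prop := {
  wavefront_direction : euclidean_norm nu = 1;
  wavefront_C2_phi : C2 phi;
  wavefront_C2_theta : C2 theta;
  wavefront_solves :
    solves_system r b (plane_wave c nu phi) (plane_wave c nu theta);
  wavefront_phi_minfty : is_lim phi m_infty 0;
  wavefront_theta_minfty : is_lim theta m_infty 1;
  wavefront_phi_pinfty : is_lim phi p_infty 1;
  wavefront_theta_pinfty : is_lim theta p_infty 0
}.

Definition monotone (f : R -> R) : Prop :=
  (forall x y : R, x <= y -> f x <= f y) \/
  (forall x y : R, x <= y -> f y <= f x).

Record is_positive_monotone_wavefront (n : nat) (r b c : R) (nu : 'I_n -> R)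
    (phi theta : R -> R) : Prop := {
  pmw_wavefront : is_wavefront r b c nu phi theta;
  pmw_phi_pos : forall z : R, 0 < phi z;
  pmw_theta_pos : forall z : R, 0 < theta z;
  pmw_phi_monotone : monotone phi;
  pmw_theta_monotone : monotone theta
}.

Definition admissible (n : nat) (r b c : R) : Prop :=
  exists (nu : 'I_n -> R) (phi theta : R -> R),
    is_positive_monotone_wavefront r b c nu phi theta.

Definition profile_equations (r b c : R) (phi theta : R -> R) : Prop :=
  forall z : R,
    Derive_n phi 2 z - c * Derive phi z
      + phi z * (1 - phi z - r * theta z) = 0 /\
    Derive_n theta 2 z - c * Derive theta z - b * phi z * theta z = 0.

Lemma sumR_scal (n : nat) (a : R) (F : 'I_n -> R) :
  \big[Rplus/0]_(i < n) (F i * a) = (\big[Rplus/0]_(i < n) F i) * a.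
Proof. by elim/big_rec2: _ => [|i x y _ ->]; ring. Qed.

Lemma dot_update (n : nat) (nu x : 'I_n -> R) (i : 'I_n) (s : R) :
  dot nu (update x i s) = nu i * s + (dot nu x - nu i * x i).
Proof.
have shift : forall l : seq 'I_n, uniq l ->
    \big[Rplus/0]_(j <- l) (nu j * update x i s j) =
    \big[Rplus/0]_(j <- l) (nu j * x j)
      + (if i \in l then nu i * (s - x i) else 0).
  elim=> [|j l IH] /=; first by rewrite !big_nil Rplus_0_r.
  case/andP=> jl ul; rewrite !big_cons in_cons (IH ul) /update.
  case: (eqVneq j i) => [<-|ne]; first by rewrite (negbTE jl) /=; lra.
  by rewrite /= Rplus_assoc.
by rewrite /dot shift ?index_enum_uniq // mem_index_enum /=; ring.
Qed.

Lemma Derive_comp_affine (f : R -> R) (a d z : R) :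
  (forall y, ex_derive f y) ->
  Derive (fun s => f (a * s + d)) z = a * Derive f (a * z + d).
Proof.
move=> df; apply: is_derive_unique; auto_derive; first exact: df.
by rewrite Rmult_1_r.
Qed.

Lemma Derive2_comp_affine (f : R -> R) (a d z : R) : C2 f ->
  Derive_n (fun s => f (a * s + d)) 2 z = a * a * Derive_n f 2 (a * z + d).
Proof.
case=> df _ /=.
rewrite (Derive_ext _ (fun s => a * Derive f (a * s + d))); last first.
  by move=> y; apply: Derive_comp_affine => w; apply: (df 1%N).
rewrite Derive_scal Derive_comp_affine; first by rewrite Rmult_assoc.
by move=> w; apply: (df 2%N).
Qed.

Lemma laplacian_plane_wave (n : nat) (c : R) (nu x : 'I_n -> R) (f : R -> R)
    (t : R) : euclidean_norm nu = 1 -> C2 f ->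
  laplacian (plane_wave c nu f t) x = Derive_n f 2 (dot nu x + c * t).
Proof.
move=> nu1 f2.
have nn : dot nu nu = 1.
  case: (Rle_lt_dec 0 (dot nu nu)) => hd.
    by rewrite -(sqrt_sqrt _ hd) -/(euclidean_norm nu) nu1; ring.
  by move: nu1; rewrite /euclidean_norm sqrt_neg_0; lra.
rewrite /laplacian -[RHS]Rmult_1_l -nn {1}/dot -sumR_scal.
apply: eq_bigr => i _.
rewrite (Derive_n_ext _
  (fun s => f (nu i * s + (dot nu x - nu i * x i + c * t)))); last first.
  by move=> s; rewrite /plane_wave dot_update Rplus_assoc.
by rewrite Derive2_comp_affine //; congr (_ * Derive_n f 2 _); ring.
Qed.

Lemma solves_system_plane_wave (n : nat) (r b c : R) (nu : 'I_n -> R)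
    (phi theta : R -> R) :
  euclidean_norm nu = 1 -> C2 phi -> C2 theta ->
  solves_system r b (plane_wave c nu phi) (plane_wave c nu theta) <->
  profile_equations r b c phi theta.
Proof.
move=> nu1 phi2 theta2.
have dt f t x : C2 f -> Derive (fun tau => plane_wave c nu f tau x) t =
    c * Derive f (dot nu x + c * t).
  case=> df _; rewrite (Derive_ext _ (fun tau => f (c * tau + dot nu x))).
    rewrite Derive_comp_affine; last by move=> y; apply: (df 1%N).
    by rewrite Rplus_comm.
  by move=> s; rewrite /plane_wave Rplus_comm.
split=> H.
- move=> z.
  have [i nui] : exists i, nu i <> 0.
    case: (pickP (fun i => ~~ Req_EM_T (nu i) 0)) => [i|h].
      by case: Req_EM_T => // ne _; exists i.
    suff d0 : dot nu nu = 0 by move: nu1; rewrite /euclidean_norm d0 sqrt_0; lra.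
    rewrite /dot; elim/big_rec: _ => // i y _ ->.
    by move: (h i); case: Req_EM_T => // nui0 _; rewrite nui0; ring.
  have zE : dot nu (update nu i (nu i + (z - dot nu nu) / nu i)) + c * 0 = z.
    by rewrite dot_update; field.
  have := H 0 (update nu i (nu i + (z - dot nu nu) / nu i)).
  rewrite !dt // !laplacian_plane_wave // /plane_wave zE => -[h1 h2].
  by split; lra.
- move=> t x; rewrite !dt // !laplacian_plane_wave // /plane_wave.
  by have [h1 h2] := H (dot nu x + c * t); split; lra.
Qed.

(* Main.v *)
(* Profiles obey a comparison principle on half-lines: if at some pair of times
   phi1 <= phi2 and theta1 >= theta2, then this persists forever (slide one
   profile; near (1,0) the linearization is stable, so the maximum principle
   handles infinity). Let tau match the first components, phi2 (tau t) = phi1 t.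
   Comparison shows that theta1 t - theta2 (tau t) has a constant sign, say
   nonnegative, and that then tau' <= 1. Both fluxes theta' - c theta increase
   from -c to 0, at rates b phi theta; matched through tau, the second has the
   rate b phi1 theta2(tau) tau' <= b phi1 theta1. The total increments agree,
   so tau' = 1 and the fronts are translates. No asymptotics at the degenerate
   equilibrium (0,1) are needed. *)
Require Import Defs.
From Stdlib Require Import Reals Lra Classical IndefiniteDescription.
From mathcomp Require Import all_boot.
From Coquelicot Require Import Coquelicot.
Open Scope R_scope.

(** * One-variable calculus and the strong maximum principle *)

Lemma mvt (f g : R -> R) (x y : R) :
  (forall t, is_derive f t (g t)) -> x <= y ->
  exists2 z, x <= z <= y & f y - f x = g z * (y - x).
Proof.
move=> df xy; have [||z [hz e]] := MVT_gen f x y g.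
- by move=> t _; exact: df.
- move=> t _; apply/continuity_pt_filterlim.
  by apply: (ex_derive_continuous f); exists (g t).
by exists z => //; move: hz; rewrite Rmin_left // Rmax_right.
Qed.

Lemma is_derive_continuity (f : R -> R) (x l : R) :
  is_derive f x l -> continuity_pt f x.
Proof.
by move=> df; apply/continuity_pt_filterlim/(ex_derive_continuous f); exists l.
Qed.

Lemma is_derive_pos_right (f : R -> R) (x l : R) : is_derive f x l -> 0 < l ->
  exists2 d, 0 < d & forall t, x < t < x + d -> f x < f t.
Proof.
move=> /is_derive_Reals df l0; have [d hd] := df _ l0.
exists d; first exact: cond_pos.
move=> t ht; have /hd : t - x <> 0 by lra.
rewrite Rabs_right; last lra.
move=> /(_ ltac:(lra)) /Rabs_def2 [_]; rewrite (_ : x + (t - x) = t); last ring.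
move=> h; have : 0 < (f t - f x) / (t - x) by lra.
move=> /(Rmult_lt_compat_r (t - x) _ _ ltac:(lra)).
by rewrite Rmult_0_l /Rdiv Rmult_assoc Rinv_l; lra.
Qed.

Lemma local_max_derive (f : R -> R) (x l : R) : is_derive f x l ->
  locally x (fun t => f t <= f x) -> l = 0.
Proof.
move=> df [e he]; have e0 := cond_pos e.
have pr : derivable_pt f x by exists l; apply/is_derive_Reals.
rewrite -(is_derive_unique _ _ _ df) -(Derive_Reals _ _ pr).
apply: (deriv_maximum f (x - e) (x + e)); try lra.
move=> t h1 h2; apply: he; rewrite /ball /= /AbsRing_ball /=.
by apply: Rabs_def1; rewrite /minus /plus /opp /=; lra.
Qed.

Lemma local_max_derive2 (f g : R -> R) (x l : R) :
  (forall t, is_derive f t (g t)) -> is_derive g x l ->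
  locally x (fun t => f t <= f x) -> g x = 0 /\ l <= 0.
Proof.
move=> df dg hx; have g0 := local_max_derive _ _ _ (df x) hx; split=> //.
apply: Rnot_lt_le => l0; have [d d0 hd] := is_derive_pos_right _ _ _ dg l0.
case: hx => e he; have he' t : Rabs (t - x) < e -> f t <= f x by exact: he.
have e0 := cond_pos e; have m0 : 0 < Rmin d e by apply: Rmin_glb_lt.
have := Rmin_l d e; have := Rmin_r d e => m1 m2.
have fx := he' (x + Rmin d e / 2); rewrite Rabs_right in fx; last lra.
(* The intermediate point may be x itself, where g vanishes, so the strict
   increase has to come from an interval away from x. *)
have [|z1 hz1 e1] := mvt f g x (x + Rmin d e / 4) df; first lra.
have [|z2 hz2 e2] :=
  mvt f g (x + Rmin d e / 4) (x + Rmin d e / 2) df; first lra.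
have g2 : 0 < g z2 by have := hd z2; lra.
have g1 : 0 <= g z1.
  by case: (Req_dec z1 x) => [->|ne]; [lra|have := hd z1; lra].
have : 0 <= g z1 * (x + Rmin d e / 4 - x) by apply: Rmult_le_pos; lra.
have : 0 < g z2 * (x + Rmin d e / 2 - (x + Rmin d e / 4)).
  by apply: Rmult_lt_0_compat; lra.
by lra.
Qed.

Lemma is_derive_le (f g : R -> R) (x y : R) :
  (forall t, is_derive f t (g t)) -> x <= y ->
  (forall t, x <= t <= y -> 0 <= g t) -> f x <= f y.
Proof.
move=> df xy g0; have [z hz e] := mvt f g x y df xy.
have := g0 z hz => gz; have : 0 <= g z * (y - x) by apply: Rmult_le_pos; lra.
lra.
Qed.

(* The operator factors as (D + m)(D - l) with l - m = c and m l large; the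
   two first order factors are integrated backwards from the contact point. *)
Lemma strong_maximum (f g h : R -> R) (c A : R) :
  (forall t, is_derive f t (g t)) -> (forall t, is_derive g t (h t)) ->
  0 <= A -> (forall t, 0 <= t -> f t <= 0) ->
  (forall t, 0 <= t -> A * f t <= h t - c * g t) ->
  f 0 < 0 -> forall t, 0 <= t -> f t < 0.
Proof.
move=> df dg A0 f0 hf f00 t t0; apply: Rnot_le_lt => ft.
have {}ft : f t = 0 by have := f0 t t0; lra.
have {}t0 : 0 < t by case: t0 ft => // <-; lra.
have gt : g t = 0.
  apply: (local_max_derive f t _ (df t)).
  exists (mkposreal t t0) => y; rewrite /ball /= /AbsRing_ball /= => hy.
  rewrite ft; apply: f0.
  have := Rabs_def2 _ _ hy; rewrite /minus /plus /opp /=; lra.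
(* With this [m], both [m >= A] and [l >= 1] hold whatever the sign of [c], so [m * l >= A]. Since
   [f <= 0], this makes [h - c * g - m * l * f] nonnegative, which is the factored operator applied
   to [f]. *)
pose m := A + 1 + Rabs c; pose l := m + c.
have c1 := Rle_abs (- c); rewrite Rabs_Ropp in c1.
have l1 : 1 <= l by rewrite /l /m; lra.
have c2 := Rabs_pos c; have m0 : A <= m by rewrite /m; lra.
have mlA : A <= m * l.
  have : m * 1 <= m * l by apply: Rmult_le_compat_l; lra.
  lra.
have step2 u : 0 <= u <= t -> g u - l * f u <= 0.
  move=> hu.
  pose Z s := exp (m * s) * (g s - l * f s).
  have : Z u <= Z t.
    apply: (is_derive_le _
      (fun s => exp (m * s) * (h s - c * g s - m * l * f s))); last 2 first.
    - lra.
    - move=> s hs; apply: Rmult_le_pos; first by left; apply: exp_pos.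
      have := hf s ltac:(lra); have := f0 s ltac:(lra) => fs hs'.
      have : 0 <= (m * l - A) * - f s by apply: Rmult_le_pos; lra.
      lra.
    move=> s; rewrite /Z; auto_derive.
      split; first by exists (h s).
      by split=> //; exists (g s).
    rewrite (is_derive_unique (fun x => f x) _ _ (df s)).
    rewrite (is_derive_unique (fun x => g x) _ _ (dg s)) /l; ring.
  rewrite /Z gt ft Rmult_0_r Rminus_0_r Rmult_0_r => hZ.
  have eu := exp_pos (m * u).
  apply: Rnot_lt_le => pos.
  have := Rmult_lt_0_compat _ _ eu pos; lra.
(* By [step2], [W] is nondecreasing on [[0, t]]; but [W 0 = - f 0 > 0] while [W t = 0]. *)
pose W s := - (exp (- (l * s)) * f s).
have : W 0 <= W t.
  apply: (is_derive_le _ (fun s => exp (- (l * s)) * - (g s - l * f s))).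
  - move=> s; rewrite /W; auto_derive; first by exists (g s).
    rewrite (is_derive_unique (fun x => f x) _ _ (df s)); ring.
  - lra.
  - move=> s hs; apply: Rmult_le_pos; first by left; apply: exp_pos.
    have := step2 s hs; lra.
rewrite /W ft Rmult_0_r Rmult_0_r Ropp_0 exp_0; lra.
Qed.

(** * Front profiles: strict monotonicity, ranges and limits of the flux *)

Set Implicit Arguments.
Unset Strict Implicit.

(* The derivatives p and q are explicit arguments because [Derive] would not
   commute definitionally with translations. *)
Record front (r b c : R) (phi theta p q : R -> R) : Prop := {
  front_phi : forall t, is_derive phi t (p t);
  front_p :
    forall t, is_derive p t (c * p t - phi t * (1 - phi t - r * theta t));
  front_theta : forall t, is_derive theta t (q t);
  front_q : forall t, is_derive q t (c * q t + b * phi t * theta t);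
  front_p_pos : forall t, 0 < p t;
  front_q_neg : forall t, q t < 0;
  front_phi_minfty : is_lim phi m_infty 0;
  front_theta_minfty : is_lim theta m_infty 1;
  front_phi_pinfty : is_lim phi p_infty 1;
  front_theta_pinfty : is_lim theta p_infty 0
}.

Lemma is_lim_p_infty_finite (f : R -> R) (l : R) :
  is_lim f p_infty l -> forall e, 0 < e ->
  exists M, forall t, M < t -> Rabs (f t - l) < e.
Proof.
move=> /is_lim_spec hf e e0; have [M hM] := hf (mkposreal e e0).
by exists M.
Qed.
Arguments is_lim_p_infty_finite [f l].

Lemma is_lim_m_infty_finite (f : R -> R) (l : R) :
  is_lim f m_infty l -> forall e, 0 < e ->
  exists M, forall t, t < M -> Rabs (f t - l) < e.
Proof.
move=> /is_lim_spec hf e e0; have [M hM] := hf (mkposreal e e0).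
by exists M.
Qed.
Arguments is_lim_m_infty_finite [f l].

Lemma incr_lim_p_infty (f : R -> R) (l : R) :
  (forall x y, x < y -> f x < f y) -> is_lim f p_infty l -> forall x, f x < l.
Proof.
move=> hf fl x; apply: Rnot_le_lt => hx.
have lt1 : f x < f (x + 1) by apply: hf; lra.
have [M hM] := is_lim_p_infty_finite fl (f (x + 1) - l) ltac:(lra).
have m1 := Rmax_l M (x + 1); have m2 := Rmax_r M (x + 1).
have := hM (Rmax M (x + 1) + 1) ltac:(lra); move=> /Rabs_def2.
have := hf (x + 1) (Rmax M (x + 1) + 1) ltac:(lra); lra.
Qed.

Lemma incr_lim_m_infty (f : R -> R) (l : R) :
  (forall x y, x < y -> f x < f y) -> is_lim f m_infty l -> forall x, l < f x.
Proof.
move=> hf fl x; apply: Rnot_le_lt => hx.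
have lt1 : f (x - 1) < f x by apply: hf; lra.
have [M hM] := is_lim_m_infty_finite fl (l - f (x - 1)) ltac:(lra).
have m1 := Rmin_l M (x - 1); have m2 := Rmin_r M (x - 1).
have := hM (Rmin M (x - 1) - 1) ltac:(lra); move=> /Rabs_def2.
have := hf (Rmin M (x - 1) - 1) (x - 1) ltac:(lra); lra.
Qed.

Section Front.

Variables (r b c : R) (phi theta p q : R -> R).
Hypothesis F : front r b c phi theta p q.

Lemma front_phi_incr x y : x < y -> phi x < phi y.
Proof.
move=> xy; have [|z _ e] := mvt phi p x y (front_phi F); first lra.
have : 0 < p z * (y - x).
  by apply: Rmult_lt_0_compat; [exact: front_p_pos F z|lra].
lra.
Qed.

Lemma front_theta_decr x y : x < y -> theta y < theta x.
Proof.
move=> xy; have [|z _ e] := mvt theta q x y (front_theta F).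
  lra.
have : 0 < - q z * (y - x).
  by apply: Rmult_lt_0_compat; [have := front_q_neg F z; lra|lra].
lra.
Qed.

Lemma front_phi_nondecr x y : x <= y -> phi x <= phi y.
Proof. by case=> [/front_phi_incr|->]; lra. Qed.

Lemma front_theta_nonincr x y : x <= y -> theta y <= theta x.
Proof. by case=> [/front_theta_decr|->]; lra. Qed.

Lemma front_phi_range t : 0 < phi t < 1.
Proof.
split.
  exact: (incr_lim_m_infty front_phi_incr (front_phi_minfty F)).
exact: (incr_lim_p_infty front_phi_incr (front_phi_pinfty F)).
Qed.

Lemma front_theta_range t : 0 < theta t < 1.
Proof.
have incr x y : x < y -> - theta x < - theta y by move=> /front_theta_decr; lra.
have l1 : is_lim (fun t => - theta t) p_infty (- 0).
  exact: (is_lim_opp _ _ _ (front_theta_pinfty F)).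
have l2 : is_lim (fun t => - theta t) m_infty (- 1).
  exact: (is_lim_opp _ _ _ (front_theta_minfty F)).
have := incr_lim_p_infty incr l1 t; have := incr_lim_m_infty incr l2 t.
lra.
Qed.

Lemma front_shift s : front r b c
  (fun t => phi (t + s)) (fun t => theta (t + s))
  (fun t => p (t + s)) (fun t => q (t + s)).
Proof.
have dshift (f g : R -> R) : (forall t, is_derive f t (g t)) ->
    forall t, is_derive (fun t => f (t + s)) t (g (t + s)).
  move=> df t; evar_last.
    by apply: (is_derive_comp f (fun t => t + s) t _ 1 (df _)); auto_derive.
  by rewrite /scal /= /mult /= Rmult_1_l.
have lp (f : R -> R) (l : R) : is_lim f p_infty l ->
    is_lim (fun t => f (t + s)) p_infty l.
  move=> fl; apply: is_lim_comp fl _ _ => /=; last by exists 0.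
  apply: is_lim_plus; [exact: is_lim_id|exact: is_lim_const|done].
have lm (f : R -> R) (l : R) : is_lim f m_infty l ->
    is_lim (fun t => f (t + s)) m_infty l.
  move=> fl; apply: is_lim_comp fl _ _ => /=; last by exists 0.
  apply: is_lim_plus; [exact: is_lim_id|exact: is_lim_const|done].
case: F => *; split=> //; try (by auto).
- exact: (dshift p (fun t => c * p t - phi t * (1 - phi t - r * theta t))).
- exact: (dshift q (fun t => c * q t + b * phi t * theta t)).
Qed.

Lemma is_derive_flux t :
  is_derive (fun t => q t - c * theta t) t (b * phi t * theta t).
Proof.
evar_last.
  apply: is_derive_minus (front_q F t) _.
  exact: is_derive_scal _ _ c _ (front_theta F t).
by rewrite /minus /plus /opp /=; ring.
Qed.

(** The mean value theorem finds a point of [[t - 1, t]] where [- q] equals the decrement of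
    [theta]. The flux [q - c * theta] is nondecreasing, so from that point to [t] the value [- q]
    grows by at most [Rabs c] times the same decrement. *)
Lemma front_q_bound : 0 < b -> forall t,
  - q t <= (1 + Rabs c) * (theta (t - 1) - theta t).
Proof.
move=> b0 t.
have [|z hz ez] := mvt theta q (t - 1) t (front_theta F); first lra.
have : q z - c * theta z <= q t - c * theta t.
  apply: (is_derive_le _ _ _ _ is_derive_flux); first lra.
  move=> y _; have := front_phi_range y; have := front_theta_range y => h1 h2.
  by left; apply: Rmult_lt_0_compat; [apply: Rmult_lt_0_compat|]; lra.
have h1 := @front_theta_nonincr (t - 1) z ltac:(lra).
have h2 := @front_theta_nonincr z t ltac:(lra).
have : Rabs (c * (theta z - theta t)) <= Rabs c * (theta (t - 1) - theta t).
  rewrite Rabs_mult; apply: Rmult_le_compat_l; first exact: Rabs_pos.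
  rewrite Rabs_right; lra.
have := Rle_abs (c * (theta z - theta t)); lra.
Qed.

(** Convergence of [theta] and of its unit translate makes the bound of [front_q_bound] vanish in
    the limit; with [q < 0] this squeezes [q] to 0. Taking [x] in [Rbar] treats both ends at
    once. *)
Lemma flux_lim (b0 : 0 < b) (x : Rbar) (l : R) :
  is_lim theta x l -> is_lim (fun t => theta (t - 1)) x l ->
  is_lim (fun t => q t - c * theta t) x (- (c * l)).
Proof.
move=> h1 h2.
have hk : is_lim (fun t => (1 + Rabs c) * (theta (t - 1) - theta t)) x 0.
  rewrite (_ : Finite 0 = Rbar_mult (1 + Rabs c) (Finite (l - l))); last first.
    by rewrite /= Rminus_diag Rmult_0_r.
  by apply: is_lim_scal_l; apply: is_lim_minus h2 h1 _.
have hq : is_lim q x 0.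
  apply: (is_lim_le_le_loc
    (fun t => - ((1 + Rabs c) * (theta (t - 1) - theta t))) (fun=> 0));
    last 2 first.
  - by have := is_lim_opp _ _ _ hk; rewrite /= Ropp_0.
  - exact: is_lim_const.
  apply: filter_forall => t; have := front_q_bound b0 t.
  by have := front_q_neg F t; lra.
rewrite -[- _]Rplus_0_l.
exact: (is_lim_minus' _ _ _ _ _ hq (is_lim_scal_l theta c x l h1)).
Qed.

Lemma flux_pinfty : 0 < b ->
  is_lim (fun t => q t - c * theta t) p_infty 0.
Proof.
move=> b0; rewrite -Ropp_0 -(Rmult_0_r c); apply: flux_lim => //.
  exact: front_theta_pinfty F.
exact: front_theta_pinfty (front_shift (-1)).
Qed.

Lemma flux_minfty : 0 < b ->
  is_lim (fun t => q t - c * theta t) m_infty (- c).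
Proof.
move=> b0; rewrite -{2}(Rmult_1_r c); apply: flux_lim => //.
  exact: front_theta_minfty F.
exact: front_theta_minfty (front_shift (-1)).
Qed.

End Front.
Arguments front_phi_incr [r b c phi theta p q].
Arguments front_theta_decr [r b c phi theta p q].
Arguments front_phi_nondecr [r b c phi theta p q].
Arguments front_theta_nonincr [r b c phi theta p q].

(** The limits fix the directions of monotonicity. Strict signs follow by contact with 0: a zero of
    [theta'] would be a maximum of [theta'], where the equation gives the positive slope
    [b * phi * theta]; a zero of [phi'] is excluded one order higher. *)
Lemma positive_monotone_wavefront_front (n : nat) (r b c : R) (nu : 'I_n -> R)
    (phi theta : R -> R) : 0 < r -> 0 < b ->
  is_positive_monotone_wavefront r b c nu phi theta ->
  front r b c phi theta (Derive phi) (Derive theta).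
Proof.
move=> r0 b0 [[nu1 C2phi C2theta] sol lim1 lim2 lim3 lim4 pos1 pos2 mon1 mon2].
have {sol}eqs :=
  proj1 (solves_system_plane_wave r b c nu1 C2phi C2theta) sol.
have dphi t : is_derive phi t (Derive phi t).
  by apply: Derive_correct; apply: (proj1 C2phi 1%N).
have dtheta t : is_derive theta t (Derive theta t).
  by apply: Derive_correct; apply: (proj1 C2theta 1%N).
have dp t : is_derive (Derive phi) t
    (c * Derive phi t - phi t * (1 - phi t - r * theta t)).
  rewrite (_ : _ - _ = Derive_n phi 2 t); last by have := proj1 (eqs t); lra.
  by apply: Derive_correct; apply: (proj1 C2phi 2%N).
have dq t : is_derive (Derive theta) t
    (c * Derive theta t + b * phi t * theta t).
  rewrite (_ : _ + _ = Derive_n theta 2 t); last by have := proj2 (eqs t); lra.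
  by apply: Derive_correct; apply: (proj1 C2theta 2%N).
have {}mon1 x y : x <= y -> phi x <= phi y.
  case: mon1 => [h|h]; first exact: h.
  have [M hM] := is_lim_m_infty_finite lim1 (phi 0) (pos1 0).
  have m1 := Rmin_l M 0; have m2 := Rmin_r M 0.
  have /Rabs_def2 := hM (Rmin M 0 - 1) ltac:(lra).
  have := h (Rmin M 0 - 1) 0; lra.
have {}mon2 x y : x <= y -> theta y <= theta x.
  case: mon2 => [h|h]; last exact: h.
  have [M hM] := is_lim_p_infty_finite lim4 (theta 0) (pos2 0).
  have m1 := Rmax_l M 0; have m2 := Rmax_r M 0.
  have /Rabs_def2 := hM (Rmax M 0 + 1) ltac:(lra).
  have := h 0 (Rmax M 0 + 1); lra.
have q0 t : Derive theta t <= 0.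
  apply: Rnot_lt_le => h.
  have [d d0 hd] := is_derive_pos_right _ _ _ (dtheta t) h.
  have := hd (t + d / 2); have := mon2 t (t + d / 2); lra.
have p0 t : 0 <= Derive phi t.
  apply: Rnot_lt_le => h.
  have dn := is_derive_opp _ _ _ (dphi t).
  have [|d d0 hd] := is_derive_pos_right _ _ _ dn.
    by rewrite /opp /=; lra.
  have := hd (t + d / 2); rewrite /opp /=; have := mon1 t (t + d / 2); lra.
have qneg t : Derive theta t < 0.
  apply: Rnot_le_lt => h; have {}h : Derive theta t = 0 by have := q0 t; lra.
  have hmax : locally t (fun s => Derive theta s <= Derive theta t).
    by rewrite h; apply: filter_forall.
  have := local_max_derive _ _ _ (dq t) hmax; rewrite h.
  have : 0 < b * phi t * theta t.
    by apply: Rmult_lt_0_compat => //; apply: Rmult_lt_0_compat.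
  lra.
split=> // t; apply: Rnot_le_lt => h.
have {}h : Derive phi t = 0 by have := p0 t; lra.
(* At a zero of [phi'], a minimum of [phi'], the vanishing of [phi''] forces
   [1 - phi - r * theta = 0]. Then the third derivative is [r * phi * theta' < 0], which is
   impossible at a minimum of [phi']. *)
have [||| e hle] := local_max_derive2 (fun s => - Derive phi s)
  (fun s => - (c * Derive phi s - phi s * (1 - phi s - r * theta s))) t
  (- (c * (c * Derive phi t - phi t * (1 - phi t - r * theta t))
      - (Derive phi t * (1 - phi t - r * theta t)
         + phi t * (- Derive phi t - r * Derive theta t)))).
- by move=> s; apply: is_derive_opp (dp s).
- auto_derive.
    repeat split=> //; by [exists (Derive phi t)|exists (Derive theta t)
      |eexists; exact: dp].
  rewrite (is_derive_unique (fun x => phi x) _ _ (dphi t)).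
  rewrite (is_derive_unique (fun x => theta x) _ _ (dtheta t)).
  rewrite (is_derive_unique (fun x => Derive phi x) _ _ (dp t)); ring.
- by apply: filter_forall => s; have := p0 s; lra.
have : 0 < phi t * (r * - Derive theta t).
  apply: Rmult_lt_0_compat => //; apply: Rmult_lt_0_compat => //.
  by have := qneg t; lra.
have : phi t * (1 - phi t - r * theta t) = 0 by move: e; rewrite h; lra.
move=> /Rmult_integral [|e']; first by have := pos1 t; lra.
by move: hle; rewrite e' h; lra.
Qed.

(** * Comparison of two ordered fronts on a half-line *)

Lemma Rmax_is_lim0 (f g : R -> R) :
  is_lim f p_infty 0 -> is_lim g p_infty 0 ->
  is_lim (fun t => Rmax (f t) (g t)) p_infty 0.
Proof.
move=> hf hg; apply/is_lim_spec => e /=.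
have [M hM] := is_lim_p_infty_finite hf e (cond_pos e).
have [N hN] := is_lim_p_infty_finite hg e (cond_pos e).
exists (Rmax M N) => t ht; have m1 := Rmax_l M N; have m2 := Rmax_r M N.
have h1 := hM t ltac:(lra); have h2 := hN t ltac:(lra).
by rewrite /Rmax; case: Rle_dec.
Qed.

Lemma continuity_pt_Rmax (f g : R -> R) (x : R) :
  continuity_pt f x -> continuity_pt g x ->
  continuity_pt (fun t => Rmax (f t) (g t)) x.
Proof.
move=> hf hg.
apply: (continuity_pt_ext (fun t => (f t + g t + Rabs (f t - g t)) / 2)).
  move=> t; rewrite /Rmax; case: Rle_dec => h.
    by rewrite Rabs_left1; lra.
  by rewrite Rabs_right; lra.
apply: continuity_pt_mult; last exact: continuity_pt_const.
apply: continuity_pt_plus; first exact: continuity_pt_plus.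
apply: (continuity_pt_comp (fun t => f t - g t) Rabs).
  exact: continuity_pt_minus.
exact: Rcontinuity_abs.
Qed.

(** Far out [f] stays below the positive value [f t1], so a maximum over a compact interval is
    global on the half-line; [f a <= 0] keeps it off the endpoint. *)
Lemma halfline_max (f : R -> R) (a t1 : R) :
  (forall t, continuity_pt f t) -> is_lim f p_infty 0 ->
  f a <= 0 -> a <= t1 -> 0 < f t1 ->
  exists t, [/\ a < t, 0 < f t & forall s, a <= s -> f s <= f t].
Proof.
move=> cf lf fa at1 ft1.
have [N hN] := is_lim_p_infty_finite lf _ ft1.
have m1 := Rmax_l N t1; have m2 := Rmax_r N t1.
have [|t [tmax tN]] := continuity_ab_maj f a (Rmax N t1 + 1) ltac:(lra).
  by move=> s _; exact: cf.
have ft : f t1 <= f t by apply: tmax; lra.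
exists t; split.
- case: tN => [[//|e] _]; move: fa; rewrite e; lra.
- lra.
- move=> s hs; case: (Rle_lt_dec s (Rmax N t1 + 1)) => hs'.
    by apply: tmax.
  have /Rabs_def2 := hN s ltac:(lra); lra.
Qed.

Section TwoFronts.

Variables (r b c : R) (phi1 theta1 p1 q1 phi2 theta2 p2 q2 : R -> R).
Hypotheses (r0 : 0 < r) (b0 : 0 < b).
Hypothesis F1 : front r b c phi1 theta1 p1 q1.
Hypothesis F2 : front r b c phi2 theta2 p2 q2.

(** The diagonal coefficient in the exact linear system for [phi1 - phi2] and [theta2 - theta1].
    With this choice of signs for the differences the system is cooperative, so maximum principles
    apply to it. *)
Let alpha t := phi1 t + phi2 t - 1 + r * theta1 t.

Lemma is_derive_front_diff_phi t :
  is_derive (fun t => phi1 t - phi2 t) t (p1 t - p2 t).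
Proof. exact: is_derive_minus (front_phi F1 t) (front_phi F2 t). Qed.

Lemma is_derive_front_diff_p t : is_derive (fun t => p1 t - p2 t) t
  (c * (p1 t - p2 t) + alpha t * (phi1 t - phi2 t)
   - r * phi2 t * (theta2 t - theta1 t)).
Proof.
have := is_derive_minus _ _ _ _ _ (front_p F1 t) (front_p F2 t).
rewrite /minus /plus /opp /= /alpha => h.
evar_last; first exact: h.
ring.
Qed.

Lemma is_derive_front_diff_theta t :
  is_derive (fun t => theta2 t - theta1 t) t (q2 t - q1 t).
Proof. exact: is_derive_minus (front_theta F2 t) (front_theta F1 t). Qed.

Lemma is_derive_front_diff_q t : is_derive (fun t => q2 t - q1 t) t
  (c * (q2 t - q1 t) + b * phi2 t * (theta2 t - theta1 t)
   - b * theta1 t * (phi1 t - phi2 t)).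
Proof.
have := is_derive_minus _ _ _ _ _ (front_q F2 t) (front_q F1 t).
rewrite /minus /plus /opp /= => h.
evar_last; first exact: h.
ring.
Qed.

(* Near (1,0) the linearization of the system satisfied by phi1 - phi2 and
   theta2 - theta1 has the positive supersolution (2 r, 1). *)
Lemma front_comparison_tail (M : R) :
  (forall t, M <= t ->
    [/\ 3 / 4 <= phi1 t, 3 / 4 <= phi2 t & 2 * r * theta1 t < 3 / 4]) ->
  phi1 M <= phi2 M -> theta2 M <= theta1 M ->
  forall t, M <= t -> phi1 t <= phi2 t /\ theta2 t <= theta1 t.
Proof.
move=> near phiM thetaM t Mt.
pose X t := (phi1 t - phi2 t) / (2 * r); pose Y t := theta2 t - theta1 t.
pose G t := Rmax (X t) (Y t).
have ir : 0 < / (2 * r) by apply: Rinv_0_lt_compat; lra.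
have dX s : is_derive X s ((p1 s - p2 s) / (2 * r)).
  apply: (is_derive_ext (fun u => / (2 * r) * (phi1 u - phi2 u))).
    by move=> u; exact: Rmult_comm.
  rewrite /Rdiv (Rmult_comm (_ - _)); apply: is_derive_scal.
  exact: is_derive_front_diff_phi.
have XE s : phi1 s - phi2 s = 2 * r * X s by rewrite /X; field; lra.
suff G0 : G t <= 0.
  have := Rmax_l (X t) (Y t); have := Rmax_r (X t) (Y t).
  rewrite -/(G t) => hY hX; split; last by rewrite /Y in hY; lra.
  have := XE t; have : 0 <= 2 * r * - X t by apply: Rmult_le_pos; lra.
  lra.
apply: Rnot_lt_le => Gt.
have cG s : continuity_pt G s.
  apply: continuity_pt_Rmax.
    exact: is_derive_continuity (dX s).
  exact: is_derive_continuity (is_derive_front_diff_theta s).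
have lG : is_lim G p_infty 0.
  apply: Rmax_is_lim0.
    rewrite (_ : Finite 0 = Rbar_mult (1 - 1) (/ (2 * r))); last first.
      by rewrite /= Rminus_diag Rmult_0_l.
    apply: is_lim_scal_r; apply: is_lim_minus.
    - exact: front_phi_pinfty F1.
    - exact: front_phi_pinfty F2.
    - by [].
  rewrite (_ : Finite 0 = Finite (0 - 0)); last by rewrite Rminus_0_r.
  apply: is_lim_minus.
  - exact: front_theta_pinfty F2.
  - exact: front_theta_pinfty F1.
  - by [].
have GM : G M <= 0.
  apply: Rmax_lub; last by rewrite /Y; lra.
  rewrite /X; have : 0 <= / (2 * r) * - (phi1 M - phi2 M).
    by apply: Rmult_le_pos; lra.
  rewrite /Rdiv; lra.
have [s [Ms Gs Gmax]] := halfline_max cG lG GM Mt Gt.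
have Gloc : locally s (fun u => G u <= G s).
  have sM : 0 < s - M by lra.
  exists (mkposreal _ sM) => u; rewrite /ball /= /AbsRing_ball /= => hu.
  apply: Gmax; have := Rabs_def2 _ _ hu; rewrite /minus /plus /opp /=; lra.
have [n1 n2 n3] := near s ltac:(lra).
have rg1 := front_phi_range F1 s.
have rg2 := front_phi_range F2 s.
have rg3 := front_theta_range F1 s.
have GX u : X u <= G u by exact: Rmax_l.
have GY u : Y u <= G u by exact: Rmax_r.
have [e|e] : G s = X s \/ G s = Y s.
  by rewrite /G /Rmax; case: Rle_dec; [right|left].
(* Since [X <= G] with equality at [s], [X] itself has a local maximum there. The second derivative
   of [phi1 - phi2] is then at least [r * G s * (1 - phi2 s) > 0], a contradiction. *)
- have [|e1] := local_max_derive2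
    (fun t => phi1 t - phi2 t) (fun t => p1 t - p2 t) s _
    is_derive_front_diff_phi (is_derive_front_diff_p s).
    move: Gloc; apply: filter_imp => u; rewrite e !XE => hu.
    by apply: Rmult_le_compat_l; have := GX u; lra.
  rewrite e1 XE -/(Y s) -e.
  have a0 : 1 / 2 <= alpha s.
    have : 0 < r * theta1 s by apply: Rmult_lt_0_compat; lra.
    rewrite /alpha; lra.
  have h1 : 0 <= (alpha s - 1 / 2) * (2 * r * G s).
    by apply: Rmult_le_pos; [lra|apply: Rmult_le_pos; lra].
  have h2 : 0 <= r * phi2 s * (G s - Y s).
    by apply: Rmult_le_pos; [apply: Rmult_le_pos; lra|have := GY s; lra].
  have h3 : 0 < (1 - phi2 s) * (r * G s).
    by apply: Rmult_lt_0_compat; [lra|apply: Rmult_lt_0_compat; lra].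
  by nra.
(* Here [Y] has the maximum, and the second derivative of [theta2 - theta1] is at least
   [b * (phi2 s - 2 * r * theta1 s) * G s], positive because [2 * r * theta1 < 3 / 4 <= phi2]. *)
- have [|e1] := local_max_derive2
    (fun t => theta2 t - theta1 t) (fun t => q2 t - q1 t) s _
    is_derive_front_diff_theta (is_derive_front_diff_q s).
    move: Gloc; apply: filter_imp => u; rewrite e => hu.
    by have := GY u; rewrite -/(Y u) -/(Y s); lra.
  rewrite e1 XE -/(Y s) -e => h.
  have h1 : 0 <= b * theta1 s * (2 * r * (G s - X s)).
    by apply: Rmult_le_pos; apply: Rmult_le_pos; have := GX s; lra.
  have h2 : 0 < b * ((phi2 s - 2 * r * theta1 s) * G s).
    by apply: Rmult_lt_0_compat => //; apply: Rmult_lt_0_compat; lra.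
  by nra.
Qed.

Lemma front_comparison_strict :
  (forall t, 0 <= t -> phi1 t <= phi2 t /\ theta2 t <= theta1 t) ->
  phi1 0 < phi2 0 -> theta2 0 < theta1 0 ->
  forall t, 0 <= t -> phi1 t < phi2 t /\ theta2 t < theta1 t.
Proof.
move=> le12 lt_phi lt_theta t t0.
have rg1 s := front_phi_range F1 s.
have rg2 s := front_phi_range F2 s.
have rg3 s := front_theta_range F1 s.
split.
- suff : phi1 t - phi2 t < 0 by lra.
  apply: (strong_maximum _ _ _ c (1 + r)
    is_derive_front_diff_phi is_derive_front_diff_p) => //.
  + lra.
  + by move=> s /le12; lra.
  + move=> s /le12 [h1 h2].
    have k1 : 0 <= (1 + r - alpha s) * (phi2 s - phi1 s).
      apply: Rmult_le_pos; last lra.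
      have : 0 <= r * (1 - theta1 s) by apply: Rmult_le_pos; have := rg3 s; lra.
      by rewrite /alpha; have := rg1 s; have := rg2 s; lra.
    have k2 : 0 <= r * phi2 s * (theta1 s - theta2 s).
      by apply: Rmult_le_pos; [apply: Rmult_le_pos|]; have := rg2 s; lra.
    lra.
  + lra.
- suff : theta2 t - theta1 t < 0 by lra.
  apply: (strong_maximum _ _ _ c b
    is_derive_front_diff_theta is_derive_front_diff_q) => //.
  + lra.
  + by move=> s /le12; lra.
  + move=> s /le12 [h1 h2].
    have k1 : 0 <= b * ((1 - phi2 s) * (theta1 s - theta2 s)).
      by apply: Rmult_le_pos; [lra|apply: Rmult_le_pos; have := rg2 s; lra].
    have k2 : 0 <= b * theta1 s * (phi2 s - phi1 s).
      by apply: Rmult_le_pos; [apply: Rmult_le_pos|]; have := rg3 s; lra.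
    lra.
  + lra.
Qed.

End TwoFronts.

(** * The sliding argument *)

Lemma front_near_pinfty (r b c : R) (phi theta p q : R -> R) :
  front r b c phi theta p q -> forall k e, k < 1 -> 0 < e ->
  exists2 M, 0 <= M & forall t, M <= t -> k <= phi t /\ theta t < e.
Proof.
move=> F k e k1 e0.
have [M hM] := is_lim_p_infty_finite (front_phi_pinfty F)
  (1 - k) ltac:(lra).
have [N hN] := is_lim_p_infty_finite (front_theta_pinfty F) e e0.
have m1 := Rmax_l M N; have m2 := Rmax_r M N; have m3 := Rmax_l 0 (Rmax M N).
have m4 := Rmax_r 0 (Rmax M N).
exists (Rmax 0 (Rmax M N) + 1) => [|t ht]; first lra.
have /Rabs_def2 := hM t ltac:(lra); have /Rabs_def2 := hN t ltac:(lra); lra.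
Qed.
Arguments front_near_pinfty [r b c phi theta p q].

(* Sliding: the time shifts of the second front that dominate the first one on
   the half-line form a closed set, which is also open at every positive shift
   by the strong maximum principle. *)
Lemma front_comparison0 (r b c : R)
    (phi1 theta1 p1 q1 phi2 theta2 p2 q2 : R -> R) : 0 < r -> 0 < b ->
  front r b c phi1 theta1 p1 q1 -> front r b c phi2 theta2 p2 q2 ->
  phi1 0 <= phi2 0 -> theta2 0 <= theta1 0 ->
  forall t, 0 <= t -> phi1 t <= phi2 t /\ theta2 t <= theta1 t.
Proof.
move=> r0 b0 F1 F2 phi0 theta0.
pose ord s t := phi1 t <= phi2 (t + s) /\ theta2 (t + s) <= theta1 t.
have incr2 := front_phi_nondecr F2.
have decr2 := front_theta_nonincr F2.
(* The tail comparison reduces the order on the half-line to [[0, M]]. One [M] serves all shifts,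
   since a forward shift only raises [phi2]. *)
have [M [M0 extend]] : exists M, 0 <= M /\ forall s, 0 <= s ->
    (forall t, 0 <= t <= M -> ord s t) -> forall t, 0 <= t -> ord s t.
  have e0 : 0 < 3 / 4 / (2 * r) by apply: Rdiv_lt_0_compat; lra.
  have [M1 M10 hM1] := front_near_pinfty F1 (3 / 4) _ ltac:(lra) e0.
  have [M2 M20 hM2] := front_near_pinfty F2 (3 / 4) _ ltac:(lra) e0.
  have m1 := Rmax_l M1 M2; have m2 := Rmax_r M1 M2.
  exists (Rmax M1 M2); split=> [|s s0 hs t t0]; first lra.
  case: (Rle_lt_dec t (Rmax M1 M2)) => ht; first by apply: hs; lra.
  have [hphi htheta] := hs (Rmax M1 M2) ltac:(lra).
  apply: (front_comparison_tail r0 b0 F1 (front_shift F2 s) _ hphi htheta);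
    last lra.
  move=> u hu; have [a1 a2] := hM1 u ltac:(lra).
  have [a3 _] := hM2 u ltac:(lra); have := incr2 u (u + s) ltac:(lra).
  have := Rmult_lt_compat_l (2 * r) _ _ ltac:(lra) a2.
  rewrite (_ : 2 * r * (3 / 4 / (2 * r)) = 3 / 4); last by field; lra.
  by split; lra.
(* Sliding starts from a shift so large that the second front is already beyond the values of the
   first one at [M], its extreme values on [[0, M]]. *)
have [s0 s00 hs0] : exists2 s0, 0 <= s0 & forall t, 0 <= t -> ord s0 t.
  have [_ k1] := front_phi_range F1 M.
  have [e0 _] := front_theta_range F1 M.
  have [s s0 hs] := front_near_pinfty F2 _ _ k1 e0.
  exists s => //; apply: extend => // t ht.
  have [h1 h2] := hs (t + s) ltac:(lra).
  have := front_phi_nondecr F1 t M ltac:(lra).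
  have := front_theta_nonincr F1 t M ltac:(lra).
  by split; lra.
have up s s' : s <= s' -> (forall t, 0 <= t -> ord s t) ->
    forall t, 0 <= t -> ord s' t.
  move=> ss' hs t t0; have [h1 h2] := hs t t0.
  have := incr2 (t + s) (t + s') ltac:(lra).
  by have := decr2 (t + s) (t + s') ltac:(lra); split; lra.
suff ord0 : forall t, 0 <= t -> ord 0 t.
  by move=> t /ord0; rewrite /ord Rplus_0_r.
apply: NNPP => nord0.
(* The critical shift is the supremum of the bad ones; by [up], every shift above it is good. *)
pose B s := 0 <= s /\ ~ (forall t, 0 <= t -> ord s t).
have [||s [ub lub]] := completeness B.
- exists s0 => s [_ ns]; apply: Rnot_lt_le => lt; apply: ns.
  by apply: up hs0; lra.
- by exists 0; split; first lra.
have spos : 0 <= s by apply: ub; split; first lra.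
have above s' : s < s' -> forall t, 0 <= t -> ord s' t.
  move=> lt; apply: NNPP => ns.
  have /ub : B s' by split; first lra.
  lra.
have cont f (g : R -> R) x e : (forall t, is_derive f t (g t)) -> 0 < e ->
    exists2 d, 0 < d & forall y, Rabs (y - x) < d -> Rabs (f y - f x) < e.
  move=> df e0.
  have /continuity_pt_locally := is_derive_continuity _ _ _ (df x).
  move=> /(_ (mkposreal e e0)) [d hd]; exists d; first exact: cond_pos.
  by move=> y hy; apply: hd.
have ords t : 0 <= t -> ord s t.
  move=> t0; split; apply: Rnot_lt_le => lt.
  - have e0 : 0 < phi1 t - phi2 (t + s) by lra.
    have [d d0 hd] := cont _ _ (t + s) _ (front_phi F2) e0.
    have [h1 _] := above (s + d / 2) ltac:(lra) t t0.
    have := hd (t + (s + d / 2)).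
    rewrite (_ : t + (s + d / 2) - (t + s) = d / 2); last by ring.
    rewrite Rabs_right; last lra.
    move=> /(_ ltac:(lra)) /Rabs_def2; lra.
  - have e0 : 0 < theta2 (t + s) - theta1 t by lra.
    have [d d0 hd] := cont _ _ (t + s) _ (front_theta F2) e0.
    have [_ h1] := above (s + d / 2) ltac:(lra) t t0.
    have := hd (t + (s + d / 2)).
    rewrite (_ : t + (s + d / 2) - (t + s) = d / 2); last by ring.
    rewrite Rabs_right; last lra.
    move=> /(_ ltac:(lra)) /Rabs_def2; lra.
have {}spos : 0 < s.
  case: spos => // e; case: nord0 => t t0; rewrite e; exact: ords.
have strict : forall t, 0 <= t ->
    phi1 t < phi2 (t + s) /\ theta2 (t + s) < theta1 t.
  apply: (front_comparison_strict r0 b0 F1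
    (front_shift F2 s) ords).
  - have := front_phi_incr F2 0 (0 + s) ltac:(lra); lra.
  - have := front_theta_decr F2 0 (0 + s) ltac:(lra); lra.
(* The strict gap on the compact interval leaves room for a smaller shift. *)
have room (f g f' g' : R -> R) : (forall t, is_derive f t (f' t)) ->
    (forall t, is_derive g t (g' t)) ->
    (forall t, 0 <= t -> f t < g (t + s)) ->
    exists2 d, 0 < d &
      forall u t, s - d < u <= s -> 0 <= t <= M -> f t <= g (t + u).
  move=> df dg fg.
  have dh t : is_derive (fun t => g (t + s) - f t) t (g' (t + s) - f' t).
    apply: is_derive_minus (df t); evar_last.
      by apply: (is_derive_comp g (fun t => t + s) t _ 1 (dg _)); auto_derive.
    by rewrite /scal /= /mult /= Rmult_1_l.
  have [|m [hm hm0]] := continuity_ab_min (fun t => g (t + s) - f t) 0 M M0.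
    by move=> t _; exact: is_derive_continuity (dh t).
  have e0 : 0 < g (m + s) - f m by have := fg m; lra.
  (* The margin of 1 on the left accommodates [t + u]: the radius chosen below is at most 1, so
     [u > s - 1 >= -1]. *)
  have [|d hd] := @Heine_cor2 g (-1) (M + s) _ (mkposreal _ e0).
    by move=> t _; exact: is_derive_continuity (dg t).
  have m1 := Rmin_l d 1; have m2 := Rmin_r d 1.
  exists (Rmin d 1); first by apply: Rmin_glb_lt; [exact: cond_pos|lra].
  move=> u t hu ht; have := hd (t + s) (t + u) ltac:(lra) ltac:(lra).
  rewrite (_ : t + s - (t + u) = s - u); last by ring.
  rewrite Rabs_right; last lra.
  move=> /(_ ltac:(lra)) /Rabs_def2 /=; have := hm t ht; lra.
have [d1 d10 room1] := room _ _ _ _ (front_phi F1)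
  (front_phi F2) (fun t t0 => proj1 (strict t t0)).
have [d2 d20 room2] := room (fun t => - theta1 t) (fun t => - theta2 t) _ _
  (fun t => is_derive_opp _ _ _ (front_theta F1 t))
  (fun t => is_derive_opp _ _ _ (front_theta F2 t))
  (fun t t0 => Ropp_lt_contravar _ _ (proj2 (strict t t0))).
(* Halving keeps [s - d] positive and strictly within both radii, so [s - d] is still a good shift,
   against the choice of [s]. *)
pose d := Rmin s (Rmin d1 d2) / 2.
have m1 := Rmin_l d1 d2; have m2 := Rmin_r d1 d2.
have m3 := Rmin_l s (Rmin d1 d2); have m4 := Rmin_r s (Rmin d1 d2).
have d0 : 0 < Rmin s (Rmin d1 d2).
  by apply: Rmin_glb_lt => //; apply: Rmin_glb_lt.
have : s <= s - d.
  apply: lub => u [u0 nu]; apply: Rnot_lt_le => lt; apply: nu.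
  apply: (up (s - d)); first lra.
  apply: extend; first by rewrite /d; lra.
  move=> t ht; split; first by apply: room1; rewrite /d; lra.
  have := room2 (s - d) t ltac:(rewrite /d; lra) ht; lra.
rewrite /d; lra.
Qed.

Lemma front_comparison (r b c : R)
    (phi1 theta1 p1 q1 phi2 theta2 p2 q2 : R -> R) : 0 < r -> 0 < b ->
  front r b c phi1 theta1 p1 q1 -> front r b c phi2 theta2 p2 q2 ->
  forall t1 t2, phi1 t1 <= phi2 t2 -> theta2 t2 <= theta1 t1 ->
  forall t, 0 <= t -> phi1 (t1 + t) <= phi2 (t2 + t) /\
    theta2 (t2 + t) <= theta1 (t1 + t).
Proof.
move=> r0 b0 F1 F2 t1 t2 hphi htheta t t0.
rewrite ![_ + t]Rplus_comm.
have := front_comparison0 r0 b0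
  (front_shift F1 t1) (front_shift F2 t2) _ _ t0.
by rewrite !Rplus_0_l; apply.
Qed.
Arguments front_comparison [r b c phi1 theta1 p1 q1 phi2 theta2 p2 q2].

(** * Matching two fronts by their first components *)

Section Matching.

Variables (r b c : R) (phi1 theta1 p1 q1 phi2 theta2 p2 q2 : R -> R).
Hypotheses (r0 : 0 < r) (b0 : 0 < b).
Hypothesis F1 : front r b c phi1 theta1 p1 q1.
Hypothesis F2 : front r b c phi2 theta2 p2 q2.

Lemma front_phi_surj (y : R) : 0 < y < 1 -> exists t, phi2 t = y.
Proof.
move=> hy.
have [M hM] := is_lim_m_infty_finite (front_phi_minfty F2) y ltac:(lra).
have [N hN] := is_lim_p_infty_finite (front_phi_pinfty F2) (1 - y) ltac:(lra).
have m1 := Rmin_l M N; have m2 := Rmin_r M N.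
have n1 := Rmax_l M N; have n2 := Rmax_r M N.
have /Rabs_def2 hm := hM (Rmin M N - 1) ltac:(lra).
have /Rabs_def2 hn := hN (Rmax M N + 1) ltac:(lra).
have [||t [_ ht]] := IVT_gen phi2 (Rmin M N - 1) (Rmax M N + 1) y.
- by move=> t; exact: is_derive_continuity (front_phi F2 t).
- by rewrite (Rmin_left (phi2 _)) ?(Rmax_right (phi2 _)); lra.
by exists t.
Qed.

Lemma front_matching : exists tau : R -> R, forall t, phi2 (tau t) = phi1 t.
Proof.
apply: (functional_choice (fun t u => phi2 u = phi1 t)) => t.
by apply: front_phi_surj; exact: front_phi_range F1 t.
Qed.

Variable tau : R -> R.
Hypothesis tauE : forall t, phi2 (tau t) = phi1 t.

Lemma matching_unique t u : phi1 t = phi2 u -> tau t = u.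
Proof.
rewrite -tauE => e; case: (Rtotal_order (tau t) u) => [h|[//|h]].
- by have := front_phi_incr F2 _ _ h; lra.
- by have := front_phi_incr F2 _ _ h; lra.
Qed.

Lemma matching_continuous t : continuity_pt tau t.
Proof.
apply/continuity_pt_locally => e; have e0 := cond_pos e.
have h1 := front_phi_incr F2 (tau t - e) (tau t) ltac:(lra).
have h2 := front_phi_incr F2 (tau t) (tau t + e) ltac:(lra).
pose m := Rmin (phi2 (tau t) - phi2 (tau t - e))
  (phi2 (tau t + e) - phi2 (tau t)).
have m0 : 0 < m by apply: Rmin_glb_lt; lra.
have m1 : m <= phi2 (tau t) - phi2 (tau t - e) by exact: Rmin_l.
have m2 : m <= phi2 (tau t + e) - phi2 (tau t) by exact: Rmin_r.
have /continuity_pt_locally := is_derive_continuity _ _ _ (front_phi F1 t).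
move=> /(_ (mkposreal _ m0)); apply: filter_imp => u /= /Rabs_def2.
rewrite -!tauE => hu; apply: Rabs_def1; apply: Rnot_le_lt => hle.
- have := front_phi_nondecr F2 (tau t + e) (tau u) ltac:(lra); lra.
- have := front_phi_nondecr F2 (tau u) (tau t - e) ltac:(lra); lra.
Qed.

(** By the mean value theorem for [phi2], the difference quotient of [tau] is that of [phi1] divided
    by [p2 (zeta h)], and [zeta h] tends to [tau t] because [tau] is continuous. *)
Lemma matching_derive t : is_derive tau t (p1 t / p2 (tau t)).
Proof.
have [zeta hzeta] : exists zeta : R -> R, forall h,
    Rabs (zeta h - tau t) <= Rabs (tau (t + h) - tau t) /\
    phi1 (t + h) - phi1 t = p2 (zeta h) * (tau (t + h) - tau t).
  apply: (functional_choice (fun h z =>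
    Rabs (z - tau t) <= Rabs (tau (t + h) - tau t) /\
    phi1 (t + h) - phi1 t = p2 z * (tau (t + h) - tau t))) => h.
  rewrite -!tauE; have d2 := front_phi F2.
  case: (Rle_lt_dec (tau t) (tau (t + h))) => le.
    have [z hz e] := mvt _ _ _ _ d2 le; exists z; split=> //.
    by rewrite !Rabs_right; lra.
  have [z hz e] := mvt _ _ _ _ d2 (Rlt_le _ _ le); exists z; split; last lra.
  by rewrite !Rabs_left1; lra.
have p20 z : p2 z <> 0 by have := front_p_pos F2 z; lra.
apply/is_derive_Reals/uniqueness_step3.
apply: (limit1_ext (fun h => (phi1 (t + h) - phi1 t) / h * / p2 (zeta h))).
  by move=> h h0; rewrite (proj2 (hzeta h)); field; split.
apply: limit_mul.
  by apply/uniqueness_step2/is_derive_Reals; exact: front_phi F1 t.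
apply: limit_inv => // e e0.
have /continuity_pt_locally cp :=
  is_derive_continuity _ _ _ (front_p F2 (tau t)).
have {cp} [d1 hd1] := cp (mkposreal e e0).
have /continuity_pt_locally /(_ d1) [d hd] := matching_continuous t.
exists d; split; first exact: cond_pos.
move=> h [_ hh]; apply: hd1; rewrite /ball /= /AbsRing_ball /=.
apply: Rle_lt_trans (proj1 (hzeta h)) _; apply: hd.
rewrite /ball /= /AbsRing_ball /=; move: hh; rewrite /R_dist /= /R_dist.
by rewrite /minus /plus /opp /= (_ : t + h + - t = h - 0); last by ring.
Qed.

Lemma matching_minfty : is_lim tau m_infty m_infty.
Proof.
apply/is_lim_spec => M /=.
have [N hN] := is_lim_m_infty_finite (front_phi_minfty F1)
  (phi2 M) (proj1 (front_phi_range F2 M)).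
exists N => t /hN /Rabs_def2 h; apply: Rnot_le_lt.
by move=> /(front_phi_nondecr F2); rewrite tauE; lra.
Qed.

Lemma matching_pinfty : is_lim tau p_infty p_infty.
Proof.
apply/is_lim_spec => M /=; have := front_phi_range F2 M => hM.
have [N hN] := is_lim_p_infty_finite (front_phi_pinfty F1)
  (1 - phi2 M) ltac:(lra).
exists N => t /hN /Rabs_def2 h; apply: Rnot_le_lt.
by move=> /(front_phi_nondecr F2); rewrite tauE; lra.
Qed.

(* By comparison in both directions, once the two curves meet in the
   (phi, theta)-plane they coincide from then on. *)
Lemma matching_dichotomy :
  (forall t, theta2 (tau t) <= theta1 t) \/
  (forall t, theta1 t <= theta2 (tau t)).
Proof.
pose E t := theta1 t - theta2 (tau t).
have cE t : continuity_pt E t.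
  apply: continuity_pt_minus.
    exact: is_derive_continuity (front_theta F1 t).
  apply: continuity_pt_comp; first exact: matching_continuous.
  exact: is_derive_continuity (front_theta F2 _).
have E0 t u : E t = 0 -> t <= u -> E u = 0.
  rewrite /E => et tu.
  have [|||h1 h2] := front_comparison r0 b0 F1 F2 t (tau t) _ _ (u - t).
  - by rewrite tauE; lra.
  - lra.
  - lra.
  have [|||h3 h4] := front_comparison r0 b0 F2 F1 (tau t) t _ _ (u - t).
  - by rewrite tauE; lra.
  - lra.
  - lra.
  rewrite (_ : t + (u - t) = u) in h1 h2 h3 h4; last by ring.
  (* The two comparisons give [phi1 u = phi2 (tau t + (u - t))], which identifies [tau u], and
     equality of the second components at these times. *)
  by rewrite (@matching_unique u (tau t + (u - t))); lra.
case: (classic (forall t, 0 <= E t)) => h.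
  by left=> t; have := h t; rewrite /E; lra.
right=> v; apply: Rnot_lt_le => hv; apply: h => u; apply: Rnot_lt_le => hu.
have {}hv : 0 < E v by rewrite /E; lra.
(* A sign change yields a zero of [E] between [u] and [v]; by [E0] it propagates to the later of the
   two, where [E] is nonzero. *)
have [|t [ht et]] := IVT_gen E u v 0 cE.
  by rewrite Rmin_left ?Rmax_right; lra.
have := E0 t u et; have := E0 t v et.
have := Rmax_l u v; have := Rmax_r u v.
by move: ht; rewrite /Rmin /Rmax; case: Rle_dec; lra.
Qed.

End Matching.


(** * Rigidity of ordered fronts through the flux, and uniqueness *)

Lemma nondecr_lim_const (f : R -> R) (l : R) :
  (forall x y, x <= y -> f x <= f y) ->
  is_lim f m_infty l -> is_lim f p_infty l -> forall t, f t = l.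
Proof.
move=> incr lm lp t; apply: Rle_antisym; apply: Rnot_lt_le => lt.
- have [M hM] := is_lim_p_infty_finite lp (f t - l) ltac:(lra).
  have m1 := Rmax_l M t; have m2 := Rmax_r M t.
  have /Rabs_def2 := hM (Rmax M t + 1) ltac:(lra).
  have := incr t (Rmax M t + 1) ltac:(lra); lra.
- have [M hM] := is_lim_m_infty_finite lm (l - f t) ltac:(lra).
  have m1 := Rmin_l M t; have m2 := Rmin_r M t.
  have /Rabs_def2 := hM (Rmin M t - 1) ltac:(lra).
  have := incr (Rmin M t - 1) t ltac:(lra); lra.
Qed.

Lemma ordered_fronts_translate (r b c : R)
    (phi1 theta1 p1 q1 phi2 theta2 p2 q2 tau : R -> R) : 0 < r -> 0 < b ->
  front r b c phi1 theta1 p1 q1 -> front r b c phi2 theta2 p2 q2 ->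
  (forall t, phi2 (tau t) = phi1 t) ->
  (forall t, theta2 (tau t) <= theta1 t) ->
  exists s, forall t, phi1 t = phi2 (t + s) /\ theta1 t = theta2 (t + s).
Proof.
move=> r0 b0 F1 F2 tauE le12.
have dtau := matching_derive F1 F2 tauE.
set tau' := fun t => p1 t / p2 (tau t).
(* A slope above 1 would give [tau (t + d / 2) > tau t + d / 2], whereas comparison started at the
   matched times [t] and [tau t] gives the reverse inequality. *)
have le1 t : tau' t <= 1.
  apply: Rnot_lt_le => lt.
  have dd : is_derive (fun u => tau u - u) t (tau' t - 1).
    exact: is_derive_minus (dtau t) (is_derive_id t).
  have [|d d0 hd] := is_derive_pos_right _ _ _ dd; first lra.
  have [||h _] := front_comparison r0 b0 F1 F2 t (tau t) _
    (le12 t) (d / 2).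
  - by rewrite tauE; lra.
  - lra.
  have := hd (t + d / 2) ltac:(lra).
  have : tau (t + d / 2) <= tau t + d / 2.
    apply: Rnot_lt_le => /(front_phi_incr F2).
    by rewrite tauE; lra.
  lra.
pose D t := (q1 t - c * theta1 t) - (q2 (tau t) - c * theta2 (tau t)).
have dD t : is_derive D t
    (b * phi1 t * (theta1 t - theta2 (tau t) * tau' t)).
  evar_last.
    apply: is_derive_minus (is_derive_flux F1 t) _.
    exact: (is_derive_comp (fun s => q2 s - c * theta2 s) tau t _ _
      (is_derive_flux F2 _) (dtau t)).
  rewrite /minus /plus /opp /scal /= /mult /= tauE /tau'; ring.
have rg t := front_phi_range F1 t.
have rg2 t := front_theta_range F2 (tau t).
have le2 t : theta2 (tau t) * tau' t <= theta2 (tau t).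
  have : 0 <= theta2 (tau t) * (1 - tau' t).
    by apply: Rmult_le_pos; [have := rg2 t|have := le1 t]; lra.
  lra.
(* The flux difference [D] is nondecreasing, and its limits are [- c - (- c)] and [0 - 0], so it
   cannot move. *)
have D0 t : D t = 0.
  apply: nondecr_lim_const => [x y xy||].
  - apply: (is_derive_le _ _ _ _ dD xy) => u _.
    apply: Rmult_le_pos; first by apply: Rmult_le_pos; have := rg u; lra.
    by have := le2 u; have := le12 u; lra.
  - rewrite -(Rminus_diag (- c)).
    apply: is_lim_minus' (flux_minfty F1 b0) _.
    apply: is_lim_comp (flux_minfty F2 b0) _ _.
      exact (matching_minfty F1 F2 tauE).
    by exists 0.
  - rewrite -(Rminus_diag 0).
    apply: is_lim_minus' (flux_pinfty F1 b0) _.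
    apply: is_lim_comp (flux_pinfty F2 b0) _ _.
      exact (matching_pinfty F1 F2 tauE).
    by exists 0.
have eq12 t : theta1 t = theta2 (tau t) * tau' t.
  have e := is_derive_unique _ _ _ (dD t).
  rewrite (Derive_ext _ (fun=> 0) _ D0) Derive_const in e.
  have : 0 < b * phi1 t by apply: Rmult_lt_0_compat; have := rg t; lra.
  by case: (Rmult_integral _ _ (esym e)); lra.
(* The chain [theta2 * tau' <= theta2 <= theta1 = theta2 * tau'], with [theta2] taken at [tau t],
   collapses to equalities. *)
have tau'1 t : tau' t = 1.
  apply: (Rmult_eq_reg_l (theta2 (tau t))); last by have := rg2 t; lra.
  by have := eq12 t; have := le2 t; have := le12 t; lra.
have tau_shift t : tau t = t + tau 0.
  suff : tau t - t = tau 0 - 0 by lra.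
  have dd u : is_derive (fun u => tau u - u) u ((fun=> 0) u).
    evar_last; first exact: is_derive_minus (dtau u) (is_derive_id u).
    by rewrite -/(tau' u) tau'1 /minus /plus /opp /= /one /=; ring.
  case: (Rle_lt_dec 0 t) => ht.
    by have [z _] := mvt _ _ _ _ dd ht; lra.
  by have [z _] := mvt _ _ _ _ dd (Rlt_le _ _ ht); lra.
exists (tau 0) => t; rewrite -tau_shift tauE; split=> //.
by rewrite eq12 tau'1 Rmult_1_r.
Qed.

Unset Implicit Arguments.

Theorem theorem5 (n : nat) (r b c : R)
    (hr : 0 < r) (hr1 : r <> 1) (hb : 0 < b) (hc : admissible n r b c)
    (nu1 nu2 : 'I_n -> R) (phi1 theta1 phi2 theta2 : R -> R)
    (h1 : is_positive_monotone_wavefront r b c nu1 phi1 theta1)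
    (h2 : is_positive_monotone_wavefront r b c nu2 phi2 theta2) :
  exists s : R, forall t : R,
    phi1 (t + s) = phi2 t /\ theta1 (t + s) = theta2 t.
Proof.
have F1 := positive_monotone_wavefront_front hr hb h1.
have F2 := positive_monotone_wavefront_front hr hb h2.
(* The fronts enter in swapped order, since the translation in the conclusion acts on the first
   front. *)
have [tau tauE] := front_matching F2 F1.
have [le|le] := matching_dichotomy hr hb F2 F1 tauE.
  have [s hs] := ordered_fronts_translate hr hb F2 F1 tauE le.
  by exists s => t; have [-> ->] := hs t.
(* For the opposite order the roles are exchanged: the matching in the other direction is a right
   inverse of [tau], which carries the inequality over, and the resulting translation is
   reversed. *)
have [tau2 tau2E] := front_matching F1 F2.
have tauK u : tau (tau2 u) = u.
  by apply: (matching_unique F1 tauE); rewrite tau2E.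
have [|s hs] := ordered_fronts_translate hr hb F1 F2 tau2E.
  by move=> u; have := le (tau2 u); rewrite tauK.
exists (- s) => t; have [-> ->] := hs (t + - s).
by rewrite (_ : t + - s + s = t); last by ring.
Qed.
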